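(* Let $A$ be an $\ell$-controllable complete group system, choose a basis of $A$, and let $(\mathcal{R},* )$ and $(\mathcal{U},\circ)$ be the resulting decomposition group and generator group, with bijections $\alpha:\mathcal{R}\to A$ and $\beta:\mathcal{R}\to\mathcal{U}$. Then the composition $\xi=\beta\circ\alpha^{-1}:A\to\mathcal{U}$ is an isomorphism from the group $A$ to the group $(\mathcal{U},\circ)$, where $\alpha$ gives the isomorphism $A\simeq(\mathcal{R},* )$ and $\beta$ gives the isomorphism $(\mathcal{R},* )\simeq(\mathcal{U},\circ)$.
   Context: Let $(A^t)_{t\in\mathbf{Z}}$ be finite groups. A group system $A$ is a set of sequences $\mathbf{a}=(a^t)_{t\in\mathbf{Z}}$, $a^t\in A^t$, forming a group under componentwise operation, such that every element of $A^t$ occurs as a time-$t$ component, for each $t$. $\chi^t:A\to A^t$ is $\mathbf{a}\mapsto a^t$. $A$ is $\ell$-controllable ($\ell>0$) if for every $t\in\mathbf{Z}$ and all $\dot{\mathbf{a}},\ddot{\mathbf{a}}\in A$ there is $\mathbf{a}\in A$ agreeing with $\dot{\mathbf{a}}$ at all times $<t$ and with $\ddot{\mathbf{a}}$ at all times $\ge t+\ell$. $A$ is complete if every sequence in $\prod_t A^t$ whose restriction to each finite interval is the restriction of some element of $A$ belongs to $A$. $A^{[m,n]}$ is the set of sequences in $A$ that are the identity outside $[m,n]$. $X^t$ (resp. $Y^t$) is the normal subgroup of sequences in $A$ that are the identity at all times $<t$ (resp. $>t$). Basis: for $t\in\mathbf{Z}$, $0\le k\le\ell$ put $\Lambda^{[t,t+k]}=X^{t+1}(X^t\cap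 Y^{t+k})/X^{t+1}(X^t\cap Y^{t+k-1})$. A basis is a choice, for each $(k,t)$, of a transversal $[\Lambda^{[t,t+k]}]$ whose elements (generators $\mathbf{g}^{[t,t+k]}$) lie in $A^{[t,t+k]}$ and in which the trivial coset is represented by the identity sequence. $\mathcal{R}=\prod_{t\in\mathbf{Z}}\prod_{0\le k\le\ell}[\Lambda^{[t,t+k]}]$. The map $\alpha:\mathcal{R}\to A$ sends $\mathbf{r}=(\mathbf{g}^{[t,t+k]})_{k,t}$ to $\prod_{i=+\infty}^{-\infty}\prod_{m=0}^{\ell}\mathbf{g}^{[i,i+m]}$, i.e. the sequence with time-$t$ component $\prod_{j=0}^{\ell}\bigl(\prod_{k=j}^{\ell}\chi^t(\mathbf{g}^{[t-j,t-j+k]})\bigr)$ (factors written left to right in increasing $j$, and increasing $k$ for each $j$); $\alpha$ is a bijection. The operation $*$ on $\mathcal{R}$ is $\dot{\mathbf{r}}*\ddot{\mathbf{r}}=\alpha^{-1}(\alpha(\dot{\mathbf{r}})\alpha(\ddot{\mathbf{r}}))$; $(\mathcal{R},* )$ is the decomposition group. For each $(k,t)$ let $G_k^t$ be a set of labels with a fixed bijection $[\Lambda^{[t,t+k]}]\to G_k^t$, $\mathbf{g}^{[t,t+k]}\mapsto g_k^t$. $\mathcal{U}=\prod_{t\in\mathbf{Z}}\prod_{0\le k\le\ell}G_k^t$, and $\beta:\mathcal{R}\to\mathcal{U}$ replaces each generator by its label. The operation $\circ$ on $\mathcal{U}$ is $\beta(\dot{\mathbf{r}})\circ\beta(\ddot{\mathbf{r}})=\beta(\dot{\mathbf{r}}*\ddot{\mathbf{r}})$;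 $(\mathcal{U},\circ)$ is the generator group. *)

(* Defs.v *)
(* MathComp world, with the classical sets of MathComp-Analysis. *)
From HB Require Import structures.
From mathcomp Require Import all_boot all_order all_algebra all_fingroup.
From mathcomp Require Import boolp classical_sets functions.

Set Implicit Arguments.
Unset Strict Implicit.
Unset Printing Implicit Defensive.

Local Open Scope classical_set_scope.
Local Open Scope group_scope.

(* The subset D is a group under op.  The groups considered here are either
   sets of sequences or whole types whose operation is defined by transport,
   so the group axioms are stated for a bare operation. *)
Definition is_group T (D : set T) (op : T -> T -> T) : Prop :=
  [/\ forall x y, D x -> D y -> D (op x y),
      forall x y z, D x -> D y -> D z -> op x (op y z) = op (op x y) z
    & exists2 e, D e & forall x, D x ->
        [/\ op e x = x, op x e = x
          & exists2 y, D y & op y x = e /\ op x y = e]].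

Definition group_iso S T (D : set S) (opD : S -> S -> S)
    (E : set T) (opE : T -> T -> T) (f : S -> T) : Prop :=
  [/\ is_group D opD, is_group E opE, set_bij D E f
    & forall x y, D x -> D y -> f (opD x y) = opE (f x) (f y)].

Definition seqs (G : int -> finGroupType) : Type := forall t : int, G t.

Section SeqGroup.
Variable G : int -> finGroupType.

HB.instance Definition _ := gen_eqMixin (seqs G).
HB.instance Definition _ := gen_choiceMixin (seqs G).

Definition seq_one : seqs G := fun t => 1.
Definition seq_mul (a b : seqs G) : seqs G := fun t => a t * b t.
Definition seq_inv (a : seqs G) : seqs G := fun t => (a t)^-1.

Fact seq_mulA : associative seq_mul.
Proof. by move=> a b c; apply: functional_extensionality_dep => t; apply: mulgA. Qed.
Fact seq_mul1 : left_id seq_one seq_mul.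
Proof. by move=> a; apply: functional_extensionality_dep => t; apply: mul1g. Qed.
Fact seq_mulr1 : right_id seq_one seq_mul.
Proof. by move=> a; apply: functional_extensionality_dep => t; apply: mulg1. Qed.
Fact seq_mulV : left_inverse seq_one seq_inv seq_mul.
Proof. by move=> a; apply: functional_extensionality_dep => t; apply: mulVg. Qed.
Fact seq_mulrV : right_inverse seq_one seq_inv seq_mul.
Proof. by move=> a; apply: functional_extensionality_dep => t; apply: mulgV. Qed.

HB.instance Definition _ :=
  isGroup.Build (seqs G) seq_mulA seq_mul1 seq_mulr1 seq_mulV seq_mulrV.

End SeqGroup.

Section GroupSystem.
Variables (G : int -> finGroupType) (A : set (seqs G)).

Definition group_system : Prop :=
  is_group A *%g /\ forall (t : int) (x : G t), exists2 a, A a & a t = x.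

Definition controllable (l : nat) : Prop :=
  (0 < l)%N /\
  forall (t : int) (a1 a2 : seqs G), A a1 -> A a2 ->
    exists a, [/\ A a, forall s, (s < t)%R -> a s = a1 s
                & forall s, (t + l%:Z <= s)%R -> a s = a2 s].

Definition complete : Prop :=
  forall a : seqs G,
    (forall m n : int, exists2 b, A b &
       forall t, (m <= t <= n)%R -> b t = a t) -> A a.

(* The sequences in A that are the identity outside [m, n]. *)
Definition span_in (m n : int) : set (seqs G) :=
  [set a | A a /\ forall t, ~~ (m <= t <= n)%R -> a t = 1].

(* X^t and Y^t *)
Definition from_time (t : int) : set (seqs G) :=
  [set a | A a /\ forall s, (s < t)%R -> a s = 1].
Definition upto_time (t : int) : set (seqs G) :=
  [set a | A a /\ forall s, (t < s)%R -> a s = 1].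

(* X^(t+1) (X^t :&: Y^(t+k)); k may be -1. *)
Definition granule_num (t k : int) : set (seqs G) :=
  [set x * y | x in from_time (t + 1)%R
             & y in from_time t `&` upto_time (t + k)%R].

(* Lambda^[t,t+k], as the set of cosets of the denominator. *)
Definition granule (t k : int) : set (set (seqs G)) :=
  [set [set g * h | h in granule_num t (k - 1)%R] | g in granule_num t k].

End GroupSystem.

Definition transversal T (P : set (set T)) (D : set T) : Prop :=
  (forall x, D x -> exists2 C, P C & C x) /\
  (forall C, P C -> exists! x, D x /\ C x).

Record basis (G : int -> finGroupType) (A : set (seqs G)) (l : nat) := Basis {
  generators :> int -> 'I_l.+1 -> set (seqs G);
  generators_transversal : forall (t : int) (k : 'I_l.+1),
    transversal (granule A t k%:Z) (generators t k);
  generators_span : forall (t : int) (k : 'I_l.+1),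
    generators t k `<=` span_in A t (t + k%:Z)%R;
  (* As 1 lies in the trivial coset, it is the representative of that coset. *)
  generators_one : forall (t : int) (k : 'I_l.+1), generators t k 1 }.

Section DecompositionGroup.
Variables (G : int -> finGroupType) (A : set (seqs G)) (l : nat).
Variable B : basis A l.

(* The set R: a set coerces to the type of its elements. *)
Definition decomp : Type := forall (t : int) (k : 'I_l.+1), B t k.

Definition decomp_one : decomp :=
  fun t k => SigSub (mem_set (generators_one B t k)).

Definition alpha (r : decomp) : seqs G := fun t =>
  \prod_(j < l.+1) \prod_(k < l.+1 | (j <= k)%N)
    (set_val (r (t - j%:Z)%R k) : seqs G) t.

(* The value decomp_one is only used outside the range of alpha. *)
Definition alpha_inv : seqs G -> decomp :=
  'pinv_(fun=> decomp_one) [set: decomp] alpha.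

Definition decomp_op (r1 r2 : decomp) : decomp :=
  alpha_inv (alpha r1 * alpha r2).

End DecompositionGroup.

Section GeneratorGroup.
Variables (G : int -> finGroupType) (A : set (seqs G)) (l : nat).
Variable B : basis A l.
Variable L : int -> 'I_l.+1 -> Type.
Variable lab : forall t k, B t k -> L t k.

(* The set U *)
Definition labels : Type := forall (t : int) (k : 'I_l.+1), L t k.

Definition beta (r : decomp B) : labels := fun t k => lab (r t k).

Definition beta_inv : labels -> decomp B :=
  'pinv_(fun=> decomp_one B) [set: decomp B] beta.

Definition gen_op (u1 u2 : labels) : labels :=
  beta (decomp_op (beta_inv u1) (beta_inv u2)).

Definition xi : seqs G -> labels := beta \o alpha_inv B.

End GeneratorGroup.

(* Main.v *)
(* Writing h_t for the product of the generators starting at time t, alpha r is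
   the product ... h_(t+1) h_t h_(t-1) ....  It lies in A by completeness.  The
   granules filter X^t / X^(t+1), so by l-controllability every element of X^t
   factors uniquely as x h_t with x in X^(t+1); iterating, every sequence that
   is trivial before some time is in the range of alpha.  An expansion is
   determined from time T + l + 1 on by its sequence from time T on (see
   [alpha_stable]): this gives injectivity, and for surjectivity it lets one
   glue the expansions of sequences that are trivial in the far past and agree
   with a given one later, which exist by controllability. *)

Require Import Defs.
From mathcomp Require Import all_boot all_order all_algebra all_fingroup.
From mathcomp Require Import boolp classical_sets functions zify.

Set Implicit Arguments.
Unset Strict Implicit.
Unset Printing Implicit Defensive.

Import Order.TTheory Num.Theory.

Local Open Scope classical_set_scope.
Local Open Scope group_scope.

(** * Transporting group structures along bijections *)

Section Transport.
Variables (S T U : Type).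

(** Injectivity of [f] pulls the group laws back from [E]; surjectivity supplies the unit and the
    inverses. *)
Lemma group_iso_transport (op : S -> S -> S) (E : set T) (opE : T -> T -> T)
    (f : S -> T) :
  is_group E opE -> set_bij [set: S] E f ->
  (forall x y, f (op x y) = opE (f x) (f y)) ->
  group_iso [set: S] op E opE f.
Proof.
move=> gE fbij fM; split => //; case: gE => EM EA [e Ee E1].
case: fbij => fE finj fsurj.
have fi x y : f x = f y -> x = y by apply: finj; rewrite in_setT.
have Ef x : E (f x) by apply: fE.
split=> // [x y z _ _ _|]; first by apply: fi; rewrite !fM EA.
have [e' _ fe] := fsurj _ Ee; exists e' => // x _.
have [ex xe [y Ey [yx xy]]] := E1 _ (Ef x); have [y' _ fy] := fsurj _ Ey.
split; try by apply: fi; rewrite fM fe.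
by exists y' => //; split; apply: fi; rewrite fM fy fe.
Qed.

Lemma group_iso_inv (D : set S) (opD : S -> S -> S) (E : set T)
    (opE : T -> T -> T) (f : S -> T) (g : T -> S) :
  group_iso D opD E opE f ->
  (forall y, E y -> D (g y)) -> (forall y, E y -> f (g y) = y) ->
  group_iso E opE D opD g.
Proof.
move=> [gD gE [fE finj _] fM] gEs gK.
have DM := let: And3 h _ _ := gD in h; have EM := let: And3 h _ _ := gE in h.
have fi x y : D x -> D y -> f x = f y -> x = y.
  by move=> Dx Dy; apply: finj; rewrite inE.
split=> // [|x y Ex Ey]; last first.
  by apply: fi; rewrite ?fM ?gK; auto.
split=> [y Ey|x y|x Dx]; first exact: gEs.
  by rewrite !inE => Ex Ey /(congr1 f); rewrite !gK.
have Ef := fE _ Dx.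
by exists (f x) => //; apply: fi; rewrite ?gK; auto.
Qed.

Lemma group_iso_comp (D : set S) (opD : S -> S -> S) (E : set T)
    (opE : T -> T -> T) (F : set U) (opF : U -> U -> U) (f : S -> T)
    (g : T -> U) :
  group_iso D opD E opE f -> group_iso E opE F opF g ->
  group_iso D opD F opF (g \o f).
Proof.
move=> [gD _ fbij fM] [_ gF gbij gM]; split=> //.
  exact: set_bij_comp fbij gbij.
have fE := let: And3 h _ _ := fbij in h.
by move=> x y Dx Dy /=; rewrite fM // gM; auto.
Qed.

End Transport.

(** * Infinite products of columns with bounded support *)

Section Interleave.
Variables (G : int -> finGroupType) (l : nat).
Implicit Types (h : int -> seqs G) (s t : int).

(* The product ... h_(t+1) h_t h_(t-1) ..., when h_i is supported in
   [i, i + l]. *)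
Definition interleave h : seqs G := fun t => \prod_(j < l.+1) h (t - j%:Z)%R t.

(** Once interleaved, this is the left part [... h_(t+1) h_t] of the product. *)
Definition cut t h : int -> seqs G := fun i => if (t <= i)%R then h i else 1.

Definition supported h : Prop :=
  forall i s, ~~ (i <= s <= i + l%:Z)%R -> h i s = 1.

Lemma interleave_eq1 h t :
  (forall j, (j <= t)%R -> h j t = 1) -> interleave h t = 1.
Proof. by move=> h1; apply: big1 => j _; apply: h1; lia. Qed.

Lemma interleave_cut_lt h t s : (s < t)%R -> interleave (cut t h) s = 1.
Proof.
move=> st; apply: interleave_eq1 => i ?.
by rewrite /cut; case: lerP => //; lia.
Qed.

Lemma interleave_cut_ge h t s :
  (t + l%:Z <= s)%R -> interleave (cut t h) s = interleave h s.
Proof.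
move=> ts; apply: eq_bigr => j _; rewrite /cut; case: lerP => //.
by have := ltn_ord j; lia.
Qed.

(** At time [t + n] the column [h t] is the factor of index [n]; factors of larger index start
    before [t] and are cut, so [h t] is the rightmost one left. *)
Lemma interleave_cutS h t : supported h ->
  interleave (cut t h) = interleave (cut (t + 1)%R h) * h t.
Proof.
move=> hs; apply: functional_extensionality_dep => s.
change (interleave (cut t h) s = interleave (cut (t + 1)%R h) s * h t s).
have [st|st] := boolP (t <= s <= t + l%:Z)%R; last first.
  rewrite hs // mulg1; apply: eq_bigr => j _; rewrite /cut.
  by have jl := ltn_ord j; case: lerP => ?; case: lerP => // ?; exfalso; lia.
have [n -> nl] : exists2 n : nat, s = (t + n%:Z)%R & (n < l.+1)%N.
  by exists (absz (s - t)%R); lia.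
have split t' : (t <= t')%R -> interleave (cut t' h) (t + n%:Z)%R =
    (\prod_(0 <= j < n) cut t' h (t + n%:Z - j%:Z)%R (t + n%:Z)%R)
      * cut t' h t (t + n%:Z)%R.
  move=> tt'; pose F j := cut t' h (t + n%:Z - j%:Z)%R (t + n%:Z)%R.
  rewrite /interleave -(big_mkord xpredT F) (big_cat_nat (n := n)) ?(ltnW nl) //=.
  rewrite (big_ltn nl) [X in _ * (_ * X)]big1_seq => [|i]; last first.
    rewrite mem_index_iota => /andP[_ ni].
    by rewrite /F /cut; case: lerP => // ?; exfalso; lia.
  by rewrite mulg1 /F; congr (_ * cut t' h _ _); lia.
rewrite !split //; last lia.
have -> : cut t h t = h t by rewrite /cut lexx.
have -> : cut (t + 1)%R h t = 1 by rewrite /cut; case: lerP => // ?; lia.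
rewrite mulg1; congr (_ * _); apply: eq_big_nat => i ni; rewrite /cut.
by case: lerP => ?; case: lerP => // ?; exfalso; lia.
Qed.

End Interleave.

(** * Subgroups of a group system and the filtration of [X^t] *)

Section GroupSystem.
Variables (G : int -> finGroupType) (A : set (seqs G)).
Hypothesis gA : is_group A *%g.
Implicit Types (a x y z : seqs G) (s t : int).

Lemma system1 : A 1.
Proof.
have [_ _ [e Ae /(_ _ Ae)[ee _ _]]] := gA.
by rewrite (_ : 1 = e) //; apply: (mulgI e); rewrite ee mulg1.
Qed.

Lemma systemM x y : A x -> A y -> A (x * y).
Proof. by have [AM _ _] := gA; apply: AM. Qed.

Lemma systemV x : A x -> A x^-1.
Proof.
have [_ _ [e Ae A1]] := gA => Ax.
have [ex _ [y Ay [yx _]]] := A1 _ Ax.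
suff -> : x^-1 = y by [].
have e1 : e = 1 by apply: (mulIg x); rewrite ex mul1g.
by apply: (mulIg x); rewrite mulVg yx.
Qed.

Lemma system_prod (I : Type) (r : seq I) (P : pred I) (F : I -> seqs G) :
  (forall i, P i -> A (F i)) -> A (\prod_(i <- r | P i) F i).
Proof. by move=> AF; apply: big_ind => //; [exact: system1|exact: systemM]. Qed.

Lemma seq_prodE (I : Type) (r : seq I) (P : pred I) (F : I -> seqs G) t :
  (\prod_(i <- r | P i) F i) t = \prod_(i <- r | P i) F i t.
Proof. exact: (big_morph (fun a : seqs G => a t)). Qed.

(** By completeness it is enough to match the product on each window [[m, n]], where only the
    finitely many columns starting in [[m - l, n]] contribute. *)
Lemma interleave_mem (l : nat) (h : int -> seqs G) :
  complete A -> supported l h -> (forall i, A (h i)) -> A (interleave l h).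
Proof.
move=> cA hs Ah.
have fin n : forall h t, supported l h -> (forall i, A (h i)) ->
    (forall i, (t + n%:Z <= i)%R -> h i = 1) -> A (interleave l (cut t h)).
  elim: n => [|n IHn] {hs Ah h} h t hs Ah h1.
    rewrite (_ : interleave _ _ = 1); first exact: system1.
    apply: functional_extensionality_dep => s; apply: interleave_eq1 => i _.
    by rewrite /cut; case: lerP => // ti; rewrite h1 //; lia.
  rewrite interleave_cutS //; apply: systemM => //; apply: IHn => // i ti.
  by apply: h1; lia.
apply: cA => m n; pose h' i := if (i <= n)%R then h i else 1.
exists (interleave l (cut (m - l%:Z)%R h')).
  apply: (fin (absz (n - m + l%:Z + 1)%R) h').
  - by move=> i s ?; rewrite /h'; case: ifP => // _; apply: hs.
  - by move=> i; rewrite /h'; case: ifP => // _; apply: system1.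
  - by move=> i ?; rewrite /h'; case: lerP => //; lia.
move=> t tmn; apply: eq_bigr => j _; rewrite /cut /h'.
by have jl := ltn_ord j; case: lerP => ?; [case: lerP => // ?|]; exfalso; lia.
Qed.

(** [X^(t+1)] is the kernel of evaluation at [t] on [X^t], so only the value of [z] at [t]
    matters. *)
Lemma granule_numP t (k : int) z :
  granule_num A t k z <-> from_time A t z /\
    exists2 y, (from_time A t `&` upto_time A (t + k)%R) y & y t = z t.
Proof.
split=> [[x [Ax x1]] [y [[Ay y1] [_ y2]] <-]|[[Az z1] [y [[Ay y1] [_ y2]] yz]]].
  split; last first.
    exists y; first by split.
    by rewrite -[RHS]/(x t * y t) x1 ?mul1g //; lia.
  split=> [|s st]; first exact: systemM.
  by rewrite -[LHS]/(x s * y s) x1 ?y1 ?mul1g //; lia.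
exists (z * y^-1).
  split=> [|s st]; first by apply: systemM => //; apply: systemV.
  rewrite -[LHS]/(z s * (y s)^-1); have [->|ts] := eqVneq s t.
    by rewrite yz mulgV.
  by rewrite z1 ?y1 ?invg1 ?mulg1 //; lia.
by exists y; [split|rewrite mulgKV].
Qed.

Lemma from_timeM t x y :
  from_time A t x -> from_time A t y -> from_time A t (x * y).
Proof.
move=> [Ax x1] [Ay y1]; split=> [|s st]; first exact: systemM.
by rewrite -[LHS]/(x s * y s) x1 ?y1 ?mul1g.
Qed.

Lemma from_timeV t x : from_time A t x -> from_time A t x^-1.
Proof.
move=> [Ax x1]; split=> [|s st]; first exact: systemV.
by rewrite -[LHS]/((x s)^-1) x1 ?invg1.
Qed.

Lemma from_timeJ t a x : A a -> from_time A t x -> from_time A t (a * x * a^-1).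
Proof.
move=> Aa [Ax x1]; split=> [|s st];
    first by do 2?apply: systemM => //; apply: systemV.
by rewrite -[LHS]/(a s * x s * (a s)^-1) x1 // mulg1 mulgV.
Qed.

Lemma upto_timeM t x y :
  upto_time A t x -> upto_time A t y -> upto_time A t (x * y).
Proof.
move=> [Ax x1] [Ay y1]; split=> [|s st]; first exact: systemM.
by rewrite -[LHS]/(x s * y s) x1 ?y1 ?mul1g.
Qed.

Lemma upto_timeV t x : upto_time A t x -> upto_time A t x^-1.
Proof.
move=> [Ax x1]; split=> [|s st]; first exact: systemV.
by rewrite -[LHS]/((x s)^-1) x1 ?invg1.
Qed.

Lemma upto_timeJ t a x : A a -> upto_time A t x -> upto_time A t (a * x * a^-1).
Proof.
move=> Aa [Ax x1]; split=> [|s st];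
    first by do 2?apply: systemM => //; apply: systemV.
by rewrite -[LHS]/(a s * x s * (a s)^-1) x1 // mulg1 mulgV.
Qed.

Lemma from_time_prod t (I : Type) (r : seq I) (P : pred I) (F : I -> seqs G) :
  (forall i, P i -> from_time A t (F i)) ->
  from_time A t (\prod_(i <- r | P i) F i).
Proof.
move=> AF; apply: big_ind => //; last exact: from_timeM.
by split=> //; apply: system1.
Qed.

Lemma upto_time_prod t (I : eqType) (r : seq I) (F : I -> seqs G) :
  (forall i, i \in r -> upto_time A t (F i)) ->
  upto_time A t (\prod_(i <- r) F i).
Proof.
move=> AF; rewrite big_seq; apply: big_ind => //; last exact: upto_timeM.
by split=> //; apply: system1.
Qed.

Lemma granule_numM t k x y :
  granule_num A t k x -> granule_num A t k y -> granule_num A t k (x * y).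
Proof.
move=> /granule_numP[Xx [x' [Xx' Yx'] ex]] /granule_numP[Xy [y' [Xy' Yy'] ey]].
apply/granule_numP; split; first exact: from_timeM.
exists (x' * y'); first by split; [exact: from_timeM|exact: upto_timeM].
by rewrite -[LHS]/(x' t * y' t) ex ey.
Qed.

Lemma granule_numV t k x : granule_num A t k x -> granule_num A t k x^-1.
Proof.
move=> /granule_numP[Xx [x' [Xx' Yx'] ex]].
apply/granule_numP; split; first exact: from_timeV.
exists x'^-1; first by split; [exact: from_timeV|exact: upto_timeV].
by rewrite -[LHS]/((x' t)^-1) ex.
Qed.

Lemma granule_numJ t k a x :
  A a -> granule_num A t k x -> granule_num A t k (a * x * a^-1).
Proof.
move=> Aa /granule_numP[Xx [x' [Xx' Yx'] ex]].
apply/granule_numP; split; first exact: from_timeJ.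
exists (a * x' * a^-1); first by split; [exact: from_timeJ|exact: upto_timeJ].
by rewrite -[LHS]/(a t * x' t * (a t)^-1) ex.
Qed.

(** The filtration is exhausted at [k = l]: controllability glues [x] before [t + 1] to the identity
    from [t + 1 + l] on, which keeps the value at [t]. *)
Lemma granule_num_top (l : nat) t x :
  controllable A l -> from_time A t x -> granule_num A t l%:Z x.
Proof.
move=> [_ ctl] [Ax x1].
have [b [Ab bx b1]] := ctl (t + 1)%R x 1 Ax system1.
apply/granule_numP; split=> //; exists b; last by apply: bx; lia.
split; split=> // s st; first by rewrite bx ?x1 //; lia.
by rewrite b1 //; lia.
Qed.

(** For [k = -1] the witness [y] is already trivial at [t]. *)
Lemma granule_num_bottom t x :
  granule_num A t (- 1)%R x -> from_time A (t + 1)%R x.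
Proof.
move=> /granule_numP[[Ax x1] [y [_ [_ y1]] yx]]; split=> // s st.
have [->|ts] := eqVneq s t; first by rewrite -yx y1 //; lia.
by apply: x1; lia.
Qed.

End GroupSystem.

(** * Generators and factorization of [X^t] modulo [X^(t+1)] *)

Section Basis.
Variables (G : int -> finGroupType) (A : set (seqs G)) (l : nat).
Variable B : basis A l.
Hypotheses (gA : is_group A *%g) (cA : complete A).
Implicit Types (a x y z g : seqs G) (s t : int) (k : 'I_l.+1) (r : decomp B).

Lemma generator_mem t k g : B t k g -> A g.
Proof. by move/(@generators_span _ _ _ B t k) => []. Qed.

Lemma generator_from t k g : B t k g -> from_time A t g.
Proof.
by move/(@generators_span _ _ _ B t k) => [Ag g1]; split=> // s ?; apply: g1; lia.
Qed.

Lemma generator_upto t k g : B t k g -> upto_time A (t + k%:Z)%R g.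
Proof.
by move/(@generators_span _ _ _ B t k) => [Ag g1]; split=> // s ?; apply: g1; lia.
Qed.

(** The granule consists of left cosets and the quotient here is a right one; normality of the
    denominator links the two. *)
Lemma generator_inj t k g g' : B t k g -> B t k g' ->
  granule_num A t (k%:Z - 1)%R (g' * g^-1) -> g = g'.
Proof.
move=> Bg Bg' Ngg'; have [BC BU] := generators_transversal B t k.
have [C PC Cg] := BC _ Bg; have [x [_ xU]] := BU _ PC.
have Cg' : C g'.
  have [c _ cC] := PC; move: Cg; rewrite -cC => -[n Nn gE].
  exists (n * (g^-1 * g')); last by rewrite mulgA gE mulgA mulgV mul1g.
  apply: granule_numM => //.
  have -> : g^-1 * g' = g^-1 * (g' * g^-1) * g^-1^-1 by rewrite invgK mulgA mulgKV.
  by apply: granule_numJ => //; apply: systemV => //; apply: generator_mem Bg.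
by rewrite -(xU g) // -(xU g').
Qed.

Lemma granule_num_split t k x : granule_num A t k%:Z x ->
  exists2 g, B t k g & granule_num A t (k%:Z - 1)%R (x * g^-1).
Proof.
move=> Nx; have [_ BU] := generators_transversal B t k.
have Ax : A x by case/(granule_numP gA): Nx => -[].
have /BU[g [[Bg [n Nn gE]] _]] :
  granule A t k%:Z [set x * h | h in granule_num A t (k%:Z - 1)%R] by exists x.
exists g => //; rewrite -gE invMg mulgA.
by apply: granule_numJ => //; apply: granule_numV.
Qed.

(** Descent through the filtration: representatives are split off on the right, longest first, so
    that the product reads in increasing length. *)
Lemma granule_num_factor t n x : (n <= l.+1)%N ->
    granule_num A t (n%:Z - 1)%R x ->
  exists2 g : nat -> seqs G, forall i, B t (inord i) (g i) &
    from_time A (t + 1)%R (x * (\prod_(0 <= i < n) g i)^-1).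
Proof.
elim: n x => [|n IHn] x nl Nx.
  exists (fun=> 1) => [i|]; first exact: generators_one.
  by rewrite big_nil invg1 mulg1; apply: granule_num_bottom.
have [|g0 Bg0] := @granule_num_split t (inord n) x.
  by rewrite inordK //; rewrite (_ : (n%:Z = n.+1%:Z - 1)%R) //; lia.
rewrite inordK // => /(IHn _ (ltnW nl))[g Bg Xg].
exists (fun i => if i == n then g0 else g i) => [i|].
  by case: eqP => [->|_].
rewrite big_nat_recr //= eqxx invMg mulgA.
rewrite (eq_big_nat _ _ (F2 := g)) // => i ni.
by rewrite ltn_eqF //; case/andP: ni.
Qed.

(** * Columns and the map [alpha] *)

Lemma decompP r t k : B t k (set_val (r t k)).
Proof. exact: set_valP. Qed.

(** The product [h_t], indexed by naturals through [inord] so that the range can be split. *)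
Definition column r t : seqs G := \prod_(0 <= i < l.+1) set_val (r t (inord i)).

Lemma column_from r t : from_time A t (column r t).
Proof. by apply: from_time_prod => // i _; apply: generator_from (decompP _ _ _). Qed.

Lemma column_mem r t : A (column r t).
Proof. by have [] := column_from r t. Qed.

Lemma column_supported r : supported l (column r).
Proof.
move=> t s ts; have [st|ts'] := boolP (s < t)%R.
  by have [_ ->] := column_from r t.
rewrite /column; have [|_ ->//] := @upto_time_prod _ _ gA (t + l%:Z)%R _ (index_iota 0 l.+1)
    (fun i => set_val (r t (inord i))); last lia.
move=> i _; have [Ag g1] := generator_upto (decompP r t (inord i)).
by split=> // s' ?; apply: g1; have := ltn_ord (inord i : 'I_l.+1); lia.
Qed.

(** The generators with [k < j] left out by [alpha] end at [t - j + k < t], so whole columns give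
    the same value. *)
Lemma alphaE r : alpha r = interleave l (column r).
Proof.
apply: functional_extensionality_dep => t; apply: eq_bigr => j _.
rewrite /column big_mkord seq_prodE big_mkcond /=; apply: eq_bigr => k _.
rewrite inord_val; case: leqP => // kj; symmetry.
by have [_ ->//] := generator_upto (decompP r (t - j%:Z)%R k); lia.
Qed.

Lemma alpha_mem r : A (alpha r).
Proof.
rewrite alphaE; apply: interleave_mem => //.
  exact: column_supported.
exact: column_mem.
Qed.

(* The causal parts P_t of two expansions agreeing from T on differ by some
   d_t in X^t :&: Y^(t+l-1), and h'_t d_t = d_(t+1) h_t for the columns h, h'.
   Comparing the generators of length l + 1 shows that they agree and that d_t
   lies in Y^(t+l-2); then those of length l agree, and so on. *)
Lemma alpha_stable r r' (T : int) :
    (forall s, (T <= s)%R -> alpha r s = alpha r' s) ->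
  forall t k, (T + l.+1%:Z <= t)%R -> r t k = r' t k.
Proof.
move=> rr'.
pose P q t := interleave l (cut t (column q)).
have PS q t : P q t = P q (t + 1)%R * column q t.
  exact/interleave_cutS/column_supported.
have XP q t : from_time A t (P q t).
  split=> [|s]; last exact: interleave_cut_lt.
  apply: interleave_mem => // [i s|i]; rewrite /cut; case: ifP => // _.
  - exact: column_supported.
  - exact: column_mem.
  - exact: system1.
pose d t := (P r' t)^-1 * P r t.
have Xd t : from_time A t (d t) by apply: from_timeM => //; apply: from_timeV.
have dS t : column r' t * d t = d (t + 1)%R * column r t.
  by rewrite /d !(PS _ t) invMg !mulgA mulgV mul1g.
(* Each round settles one more length, the longest first, and moves the bound on [t] up by one. *)
suff H m : (m <= l.+1)%N ->
    (forall t s, (T + m%:Z <= t)%R -> (t + l%:Z - m%:Z <= s)%R -> d t s = 1) /\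
    (forall t k, (T + m%:Z <= t)%R -> (l < m + k)%N -> r t k = r' t k).
  by move=> t k Tt; apply: (H l.+1 _).2 => //; lia.
elim: m => [_|m IHm ml].
  (* From time [t + l] on, the cut products coincide with the full ones, which agree there. *)
  split=> [t s Tt ts|t k _ lk]; last by have := ltn_ord k; lia.
  rewrite -[LHS]/((P r' t s)^-1 * P r t s) /P !interleave_cut_ge; [|lia..].
  by rewrite -!alphaE rr' ?mulVg //; lia.
have {IHm}[d1 rk] := IHm (ltnW ml).
pose j := (l - m)%N.
have step t : (T + m%:Z <= t)%R ->
    r t (inord j) = r' t (inord j) /\
    upto_time A (t + j%:Z - 1)%R (d (t + 1)%R).
  (* The column is split at [j], the longest unsettled length; the longer generators in [Hi] already
     agree. *)
  move=> Tt; pose Lo (q : decomp B) : seqs G := \prod_(0 <= i < j) set_val (q t (inord i)).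
  pose Hi (q : decomp B) : seqs G := \prod_(j.+1 <= i < l.+1) set_val (q t (inord i)).
  pose g (q : decomp B) : seqs G := set_val (q t (inord j)).
  have jl : (j < l.+1)%N by rewrite /j; lia.
  have colE q : column q t = Lo q * (g q * Hi q).
    rewrite /column (big_cat_nat (n := j)) ?(ltnW jl) //=.
    by rewrite (big_ltn jl).
  have HiE : Hi r = Hi r'.
    apply: eq_big_nat => i /andP[ji il]; rewrite rk // inordK //.
    by rewrite /j in ji; lia.
  have XLo q : from_time A t (Lo q).
    rewrite /Lo; apply: from_time_prod => //. move=> i _.
    exact: generator_from (decompP _ _ _).
  have YLo q : upto_time A (t + j%:Z - 1)%R (Lo q).
    apply: upto_time_prod => // i; rewrite mem_index_iota => /andP[_ ij].
    have [Ag g1] := generator_upto (decompP q t (inord i)).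
    by split=> // s ?; apply: g1; rewrite inordK; lia.
  have Ag q : A (g q) by apply: generator_mem (decompP _ _ _).
  have AHi q : A (Hi q).
    by apply: system_prod => // i _; apply: generator_mem (decompP _ _ _).
  have Yd : upto_time A (t + j%:Z - 1)%R (d t).
    by split=> [|s ?]; [case: (Xd t)|apply: d1 => //; rewrite /j; lia].
  have N1 y : from_time A t y -> upto_time A (t + j%:Z - 1)%R y ->
      granule_num A t (j%:Z - 1)%R y.
    move=> Xy Yy; apply/granule_numP => //; split=> //; exists y => //; split=> //.
    by rewrite (_ : (t + (j%:Z - 1) = t + j%:Z - 1)%R) //; lia.
  have N2 y : from_time A (t + 1)%R y -> granule_num A t (j%:Z - 1)%R y.
    move=> [Ay y1]; apply/granule_numP => //; split.
      by split=> // s ?; apply: y1; lia.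
    exists 1; last by rewrite y1 //; lia.
    by split; split=> //; apply: system1.
  have d1E : d (t + 1)%R =
      Lo r' * (g r' * Hi r) * d t * (Lo r * (g r * Hi r))^-1.
    by rewrite -colE HiE -colE dS mulgK.
  (* Every factor lies in [X^(t+1) (X^t :&: Y^(t+j-1))]: [d (t + 1)] through [X^(t+1)], the others
     through [X^t :&: Y^(t+j-1)], up to conjugation. *)
  have geE : g r' * (g r)^-1 =
      (Lo r')^-1 * d (t + 1)%R * Lo r *
      ((g r * Hi r) * (d t)^-1 * (g r * Hi r)^-1).
    by rewrite d1E !invMg !mulgA mulVg mul1g !mulgKV !mulgK.
  have ge : g r = g r'.
    apply: (@generator_inj t (inord j)); try exact: decompP.
    rewrite inordK // geE; apply: granule_numM => //; last first.
      by apply: granule_numJ => //; [apply: systemM|apply/granule_numV/N1].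
    apply: granule_numM => //; last exact: N1.
    apply: granule_numM => //; last exact: N2.
    by apply: granule_numV => //; apply: N1.
  split; first exact: val_inj.
  (* Once the generators of length index [j] agree, only factors in the normal subgroup [Y^(t+j-1)]
     remain. *)
  have -> : d (t + 1)%R =
      Lo r' * ((g r * Hi r) * d t * (g r * Hi r)^-1) * (Lo r)^-1.
    by rewrite d1E -ge !invMg !mulgA.
  apply: upto_timeM => //; last exact: upto_timeV.
  by apply: upto_timeM => //; apply: upto_timeJ => //; apply: systemM.
split=> [t s Tt ts|t k Tt lk].
  (* A round at [t - 1] bounds [d t], hence the loss of one time unit. *)
  have [|_] := step (t - 1)%R; first lia.
  by rewrite (_ : (t - 1 + 1 = t)%R) => [[_ ->]|]; rewrite ?/j //; lia.
have [lk'|kl] := ltnP l (m + k); first by apply: rk => //; lia.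
have -> : k = inord j by apply: val_inj; rewrite /= inordK /j; lia.
by apply: (step t _).1; lia.
Qed.

(** * Surjectivity and bijectivity of [alpha] *)

Lemma from_time_alpha (T : int) x : controllable A l -> from_time A T x ->
  exists r, alpha r = x.
Proof.
move=> ctl Xx.
(* Identity generators outside [X^t] make the choice total, so that the remainders [xs] can be
   defined by plain recursion. *)
have F t y : {q : forall k, B t k | from_time A t y -> from_time A (t + 1)%R
    (y * (\prod_(0 <= i < l.+1) set_val (q (inord i)))^-1)}.
  apply: cid; have [Xy|nXy] := pselect (from_time A t y); last first.
    by exists (@decomp_one _ _ _ B t).
  have [||g Bg Xg] := @granule_num_factor t l.+1 y _ _; rewrite //.
    rewrite (_ : (l.+1%:Z - 1 = l%:Z)%R); last lia.
    exact: granule_num_top.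
  have Bg' k : B t k (g k) by have := Bg k; rewrite inord_val.
  exists (fun k => SigSub (mem_set (Bg' k))).
  move=> _; congr (from_time A _ (_ * _^-1)): Xg.
  by apply: eq_big_nat => i il; rewrite /set_val /= inordK.
pose xs := fix xs n := if n is m.+1 then
  xs m * (\prod_(0 <= i < l.+1) set_val (projT1 (F (T + m%:Z)%R (xs m)) (inord i)))^-1
  else x.
pose r : decomp B := fun t => if (T <= t)%R then projT1 (F t (xs (absz (t - T)%R)))
  else @decomp_one _ _ _ B t.
have colE n : xs n.+1 = xs n * (column r (T + n%:Z)%R)^-1.
  rewrite /column /r; case: lerP => [_|]; last lia.
  by rewrite (_ : absz _ = n) //; lia.
have Xxs n : from_time A (T + n%:Z)%R (xs n).
  elim: n => [|n IHn]; first by rewrite (_ : (T + 0%:Z)%R = T) //; lia.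
  rewrite (_ : (T + n.+1%:Z = T + n%:Z + 1)%R); last lia.
  exact: (projT2 (F (T + n%:Z)%R (xs n)) IHn).
have col1 t : (t < T)%R -> column r t = 1.
  by move=> tT; apply: big1 => i _; rewrite /r; case: lerP => //; lia.
have cutE : cut T (column r) = column r.
  by apply: funext => t; rewrite /cut; case: lerP => // /col1.
pose M n := interleave l (cut (T + n%:Z)%R (column r)).
(* Invariant of the recursion: [xs n] and [M n] arise from [x] and [M 0] by removing the same [n]
   columns on the right. *)
have xM n : x * (M 0%N)^-1 = xs n * (M n)^-1.
  elim: n => [//|n ->]; rewrite colE /M interleave_cutS; last exact: column_supported.
  rewrite (_ : (T + n.+1%:Z = T + n%:Z + 1)%R); last lia.
  by rewrite invMg mulgA.
exists r; apply: functional_extensionality_dep => s.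
have -> : alpha r = M 0%N by rewrite alphaE /M (_ : (T + 0%:Z)%R = T) ?cutE //; lia.
have [sT|Ts] := ltP s T.
  by rewrite /M interleave_cut_lt ?(Xx.2 s) //; lia.
(* With [n = s - T + 1], both [xs n] and [M n] start after [s]. *)
have /(congr1 (fun a : seqs G => a s)) := xM (absz (s - T)%R).+1.
rewrite -[LHS]/(x s * (M _ s)^-1) -[RHS]/(xs _ s * (M _ s)^-1).
rewrite (Xxs (absz (s - T)%R).+1).2; last lia.
rewrite {2}/M interleave_cut_lt ?invg1 ?mulg1; last lia.
by move/eqP; rewrite -eq_mulgV1 => /eqP.
Qed.

Lemma alpha_bij : controllable A l -> set_bij [set: decomp B] A (@alpha G A l B).
Proof.
move=> ctl; split=> [r _|r r' _ _ rr'|a Aa]; first exact: alpha_mem.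
  apply: functional_extensionality_dep => t; apply: functional_extensionality_dep => k.
  by apply: (@alpha_stable r r' (t - l.+1%:Z)%R) => [s _|]; [rewrite rr'|lia].
have [_ ctl'] := ctl.
(* Controllability at [T - l] gives a sequence trivial before [T - l] and equal to [a] from [T]
   on. *)
have ex (T : int) : exists r, forall s, (T <= s)%R -> alpha r s = a s.
  have [b [Ab b1 ba]] := ctl' (T - l%:Z)%R 1 a (system1 gA) Aa.
  have [|r rb] := @from_time_alpha (T - l%:Z)%R b ctl; first by split.
  by exists r => s ?; rewrite rb ba //; lia.
have {ex}[R RE] := choice ex.
(* [t - (l + 1)] is the latest cutoff for which [alpha_stable] fixes the entry at [t]; earlier
   cutoffs give the same entry. *)
pose r : decomp B := fun t => R (t - l.+1%:Z)%R t.
have RR T t k : (T + l.+1%:Z <= t)%R -> R T t k = r t k.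
  move=> Tt; apply: (@alpha_stable _ (R (t - l.+1%:Z)%R) (t - l.+1%:Z)%R); last lia.
  by move=> s ts; rewrite !RE //; lia.
exists r => //; apply: functional_extensionality_dep => s.
(* The value at [s] reads the entries at [s - l, ..., s], all fixed by this cutoff. *)
rewrite -(RE (s - l%:Z - l.+1%:Z)%R s); last lia.
apply: eq_bigr => j _; apply: eq_bigr => k _; rewrite RR //.
by have := ltn_ord j; lia.
Qed.

End Basis.

(** * The decomposition group and the generator group *)

Theorem theorem32 (G : int -> finGroupType) (A : set (seqs G)) (l : nat)
    (B : basis A l) (L : int -> 'I_l.+1 -> Type)
    (lab : forall (t : int) (k : 'I_l.+1), B t k -> L t k) :
  group_system A -> controllable A l -> complete A ->
  (forall (t : int) (k : 'I_l.+1), bijective (lab t k)) ->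
  [/\ group_iso [set: decomp B] (@decomp_op G A l B) A *%g (@alpha G A l B),
      group_iso [set: decomp B] (@decomp_op G A l B)
                [set: labels L] (gen_op lab) (beta lab)
    & group_iso A *%g [set: labels L] (gen_op lab) (xi lab)].
Proof.
move=> [gA _] ctl cA lab_bij.
have abij := alpha_bij B gA cA ctl; have [aA _ asurj] := abij.
have aK x : A x -> alpha (alpha_inv B x) = x.
  by move=> Ax; apply: (surjpK _ asurj); rewrite inE.
have [AM _ _] := gA.
have iso1 : group_iso [set: decomp B] (@decomp_op G A l B) A *%g (@alpha G A l B).
  by apply: group_iso_transport => // x y; rewrite aK //; apply: AM; apply: aA.
have bbij : set_bij [set: decomp B] [set: labels L] (beta lab).
  split=> // [r r' _ _ rr'|u _].
    apply: functional_extensionality_dep => t.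
    apply: functional_extensionality_dep => k; apply: (bij_inj (lab_bij t k)).
    exact: (congr1 (fun u : labels L => u t k) rr').
  have f t k : {x | lab t k x = u t k}.
    by apply: cid; have [g _ gK] := lab_bij t k; exists (g (u t k)).
  exists (fun t k => sval (f t k)) => //.
  apply: functional_extensionality_dep => t.
  by apply: functional_extensionality_dep => k; apply: (svalP (f t k)).
have [_ binj bsurj] := bbij.
have bK u : beta lab (beta_inv lab u) = u by apply: (surjpK _ bsurj); rewrite inE.
have b'K r : beta_inv lab (beta lab r) = r by apply: binj; rewrite ?inE ?bK.
have iso2 : group_iso [set: decomp B] (@decomp_op G A l B)
                [set: labels L] (gen_op lab) (beta lab).
  (* [gen_op] is pulled back along [beta_inv], so transport applies to that map, and [beta] follows
     by inversion. *)
  have iso2' : group_iso [set: labels L] (gen_op lab) [set: decomp B]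
      (@decomp_op G A l B) (beta_inv lab).
    apply: group_iso_transport => [||u v]; [by case: iso1| |by rewrite b'K].
    exact: bijpinv_bij.
  by apply: (group_iso_inv iso2').
split=> //; apply: group_iso_comp iso2.
by apply: (group_iso_inv iso1).
Qed.
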